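(* Let $s\ge 1$ and let an $s$-stage Runge–Kutta method with real coefficients $a_{ij}$, $b_i$ ($1\le i,j\le s$) be given by $$X_i = x_n+ h\sum_{j=1}^s a_{ij} f(X_j)\quad (i=1,\dots,s),\qquad x_{n+1} = x_n + h \sum_{j=1}^s b_j f(X_j).$$ Suppose that the method is symplectic, i.e. $b_i b_j - b_i a_{ij} - b_j a_{ji} = 0$ for all $i$ and $j$, and that $b_i>0$ for all $i$. Then the method is a (weakly) contractive integrator in two dimensions, i.e. for ODEs $\dot x=f(x)$ with $x\in\mathbb{R}^2$.
   Context: Consider ODEs $\dot x = f(x)$, $x\in\mathbb{R}^n$, with $f$ continuously differentiable, and write $F(x)=df(x)$ for the derivative (Jacobian matrix) of the vector field $f$. A one-step method with time step $h$ is written $x_{n+1}=g(x_n)$ and its Jacobian at the point $x$ is $A=dg(x)$. The ODE is called (weakly) contractive if $\operatorname{tr}F(x)\le 0$ for all $x$. An integrator (one-step method) is called (weakly) contractive in dimension $n$ if for any matrix norm $\|\cdot\|$ and all $L>0$ there is $h^*>0$ (depending on the norm and on $L$, but not on $f$, $x$ or $h$) such that $|\det A|\le 1$ for all $0<h<h^*$, for all $x\in\mathbb{R}^n$, and for all $f$ such that $\|F(x)\|<L$ and $\operatorname{tr}F(x)\le 0$ for all $x$. For implicit methods, $h^*$ is taken small enough that for $0<h<h^*$ the defining equations determine the stages $X_i$ and $x_{n+1}$ uniquely as differentiable functions of $x_n$. *)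

(* Defs.v *)
From HB Require Import structures.
From mathcomp Require Import all_boot all_order all_algebra.
From mathcomp Require Import all_classical all_reals all_analysis.

Set Implicit Arguments.
Unset Strict Implicit.
Unset Printing Implicit Defensive.

Import Order.TTheory GRing.Theory Num.Theory.
Import numFieldNormedType.Exports.

Local Open Scope classical_set_scope.
Local Open Scope ring_scope.

(* Any norm on the vector space of n x n matrices: submultiplicativity is not
   required, so norms that have it are covered too. *)
Record matrix_norm (R : realType) (n : nat) (N : 'M[R]_n -> R) : Prop := {
  matrix_norm_ge0 : forall M, 0 <= N M;
  matrix_norm_eq0 : forall M, N M = 0 -> M = 0;
  matrix_normZ : forall (c : R) M, N (c *: M) = `|c| * N M;
  matrix_normD : forall M M', N (M + M') <= N M + N M' }.

(* 'J f x acts on row vectors from the right; its transpose is the usual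
   Jacobian matrix, with entry (i, j) equal to the j-th partial derivative of
   the i-th component. *)
Definition jacobian_matrix (R : realType) (n : nat) (f : 'rV[R]_n -> 'rV[R]_n)
  (x : 'rV[R]_n) : 'M[R]_n := ('J f x)^T.

Definition continuously_differentiable (R : realType) (n : nat)
  (f : 'rV[R]_n -> 'rV[R]_n) : Prop :=
  (forall x, differentiable f x) /\ continuous (jacobian_matrix f).

Definition contractive_ode (R : realType) (n : nat)
  (f : 'rV[R]_n -> 'rV[R]_n) : Prop :=
  forall x, \tr (jacobian_matrix f x) <= 0.

(* A possibly implicit one-step method with s internal stages is given by its
   defining equations: [Phi h f x X y] says that, for the time step h and the
   vector field f, the stages X and the new point y solve the equations of the
   step that starts at x. *)
Definition one_step_method (R : realType) (n s : nat) : Type :=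
  R -> ('rV[R]_n -> 'rV[R]_n) ->
  'rV[R]_n -> ('I_s -> 'rV[R]_n) -> 'rV[R]_n -> Prop.

(* The equations have, for every starting point x, exactly one solution,
   namely the stages X i x and the new point g x, and these are differentiable
   functions of x. *)
Definition determines (R : realType) (n s : nat) (Phi : one_step_method R n s)
  (h : R) (f : 'rV[R]_n -> 'rV[R]_n)
  (X : 'I_s -> 'rV[R]_n -> 'rV[R]_n) (g : 'rV[R]_n -> 'rV[R]_n) : Prop :=
  [/\ forall x, Phi h f x (X ^~ x) (g x),
      forall x Y y, Phi h f x Y y -> (forall i, Y i = X i x) /\ y = g x,
      forall i x, differentiable (X i) x
    & forall x, differentiable g x].

(* The bound hstar depends only on Phi, the norm and L. That the equations of
   an implicit method are solvable below hstar is part of the conclusion. *)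
Definition contractive_integrator (R : realType) (n s : nat)
  (Phi : one_step_method R n s) : Prop :=
  forall N : 'M[R]_n -> R, matrix_norm N ->
  forall L : R, 0 < L ->
  exists2 hstar : R, 0 < hstar &
    forall h : R, 0 < h < hstar ->
    forall f : 'rV[R]_n -> 'rV[R]_n, continuously_differentiable f ->
    (forall x, N (jacobian_matrix f x) < L) -> contractive_ode f ->
    exists X g, determines Phi h f X g /\
      forall x, `|\det (jacobian_matrix g x)| <= 1.

Definition runge_kutta (R : realType) (n s : nat) (a : 'M[R]_s) (b : 'I_s -> R)
  : one_step_method R n s :=
  fun h f x X y =>
    (forall i, X i = x + h *: \sum_(j < s) a i j *: f (X j)) /\
    y = x + h *: \sum_(j < s) b j *: f (X j).

Arguments runge_kutta {R} n {s} a b.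

Definition symplectic (R : realType) (s : nat) (a : 'M[R]_s) (b : 'I_s -> R)
  : Prop :=
  forall i j, b i * b j - b i * a i j - b j * a j i = 0.

(* Main.v *)
(* In the plane, differentiating the stage equations and using the invariance
   of the skew form J under symplectic methods, every term quadratic in the
   Jacobians F_i = df(X_i) cancels; since M J M^T = (det M) J and
   F J + J F^T = (tr F) J for 2 x 2 matrices, what is left is
     det A = 1 + h sum_i b_i tr(F_i) det(dX_i).
   For small h each dX_i is close to the identity, so 0 <= det(dX_i) <= 2, the
   sum is nonpositive and bounded by a multiple of h, and -1 <= det A <= 1.
   Solvability is the contraction principle on the space of s x n matrices whose
   rows are the stages; the mean value inequality and the equivalence of norms
   make f globally Lipschitz with a constant depending only on L and the norm. *)
From HB Require Import structures.
Require Import Defs.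
From mathcomp Require Import all_boot all_order all_algebra.
From mathcomp Require Import all_classical all_reals all_analysis.
From mathcomp Require Import ring lra.
Import Order.TTheory GRing.Theory Num.Theory.
Import numFieldNormedType.Exports.
Set Implicit Arguments.
Unset Strict Implicit.
Unset Printing Implicit Defensive.
Local Open Scope ring_scope.

(** * Continuity of Lipschitz maps and comparison of norms on matrices *)

Lemma lipschitz_continuous {R : realType} (V W : normedModType R) (f : V -> W)
    (c : R) : (forall x y, `|f x - f y| <= c * `|x - y|) -> continuous f.
Proof.
move=> fc x; apply/cvgrPdist_le => e e0; near=> y.
have c0 : 0 < `|c| + 1 by rewrite ltr_wpDl.
rewrite (le_trans (fc _ _))// (@le_trans _ _ ((`|c| + 1) * `|x - y|))//.
  by rewrite ler_wpM2r// (le_trans (ler_norm _))// lerDl.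
rewrite -ler_pdivlMl//; near: y.
by apply: cvgr_dist_le; [exact: cvg_id|rewrite mulr_gt0// invr_gt0].
Unshelve. all: by end_near. Qed.

Section MatrixNorm.
Context {R : realType}.

Lemma mx_norm_leP m n (M : 'M[R]_(m, n)) (e : R) : 0 <= e ->
  reflect (forall i j, `|M i j| <= e) (`|M| <= e).
Proof.
move=> e0; rewrite [`|M|]/Num.norm/= mx_normrE.
apply: (iffP (bigmax_leP _ _ _ _)) => [[_ Me] i j|Me].
  exact: (Me (i, j) isT).
by split=> // -[i j] _; exact: Me.
Qed.

Lemma mx_norm_coord m n (M : 'M[R]_(m, n)) i j : `|M i j| <= `|M|.
Proof. by move: i j; apply/mx_norm_leP. Qed.

(** The norm is the largest absolute value of an entry, which is not submultiplicative; the factor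
    [n] counts the terms in an entry of the product. *)
Lemma mx_norm_mul m n p (A : 'M[R]_(m, n)) (B : 'M[R]_(n, p)) :
  `|A *m B| <= n%:R * `|A| * `|B|.
Proof.
apply/mx_norm_leP; first by rewrite !mulr_ge0.
move=> i j; rewrite mxE (le_trans (ler_norm_sum _ _ _))//.
rewrite -mulrA; apply: (@le_trans _ _ (\sum_(k < n) `|A| * `|B|)).
  by apply: ler_sum => k _; rewrite normrM ler_pM// mx_norm_coord.
by rewrite sumr_const card_ord mulr_natl.
Qed.

Lemma mx_norm_tr m n (M : 'M[R]_(m, n)) : `|M^T| = `|M|.
Proof.
apply/eqP; rewrite eq_le; apply/andP; split; apply/mx_norm_leP => // i j.
  by rewrite mxE mx_norm_coord.
by rewrite -[M in leLHS]trmxK mxE mx_norm_coord.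
Qed.

Lemma matrix_norm_sum n (N : 'M[R]_n -> R) (I : finType) (F : I -> 'M[R]_n) :
  matrix_norm N -> N (\sum_i F i) <= \sum_i N (F i).
Proof.
move=> nN; elim/big_ind2 : _ => // [|x a y b xa yb].
  by rewrite -(scale0r (0 : 'M[R]_n)) matrix_normZ// normr0 mul0r.
by rewrite (le_trans (matrix_normD nN _ _))// lerD.
Qed.

Lemma matrix_norm_le_mx_norm n (N : 'M[R]_n -> R) : matrix_norm N ->
  exists2 c : R, 0 <= c & forall M, N M <= c * `|M|.
Proof.
move=> nN; exists (\sum_i \sum_j N (delta_mx i j)).
  by apply: sumr_ge0 => i _; apply: sumr_ge0 => j _; exact: matrix_norm_ge0.
move=> M; rewrite [X in N X]matrix_sum_delta mulr_suml.
rewrite (le_trans (matrix_norm_sum _ nN))//; apply: ler_sum => i _.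
rewrite mulr_suml (le_trans (matrix_norm_sum _ nN))//; apply: ler_sum => j _.
rewrite matrix_normZ// mulrC ler_wpM2l ?mx_norm_coord//.
exact: matrix_norm_ge0.
Qed.

Lemma mx_norm_vec_mx m n (v : 'rV[R]_(m * n)) : `|vec_mx v| = `|v|.
Proof.
apply/eqP; rewrite eq_le; apply/andP; split; apply/mx_norm_leP => // i j.
  by rewrite mxE mx_norm_coord.
by rewrite ord1 -[v in leLHS]vec_mxK; case/mxvec_indexP: j => i' j';
  rewrite mxvecE mx_norm_coord.
Qed.

(** Compactness: [N] is Lipschitz for the entrywise norm, so it attains a minimum on the unit
    sphere, positive by definiteness. By homogeneity [C] is the reciprocal of that minimum. Matrices
    are flattened to row vectors, where closed bounded sets are compact. *)
Lemma mx_norm_le_matrix_norm n (N : 'M[R]_n -> R) : matrix_norm N ->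
  exists2 C : R, 0 < C & forall M, `|M| <= C * N M.
Proof.
move=> nN.
have [c c0 Nc] := matrix_norm_le_mx_norm nN.
pose S : set 'rV[R]_(n * n) := [set v | `|v| = 1]%classic.
pose g (v : 'rV[R]_(n * n)) := N (vec_mx v).
have NN M : N (- M) = N M by rewrite -scaleN1r matrix_normZ// normrN1 mul1r.
have gB v w : `|g v - g w| <= c * `|v - w|.
  rewrite -mx_norm_vec_mx linearB (le_trans _ (Nc _))// ler_norml; apply/andP.
  split.
    rewrite lerNl opprB lerBlDr -NN opprB (le_trans _ (matrix_normD nN _ _))//.
    by rewrite subrK.
  by rewrite lerBlDr (le_trans _ (matrix_normD nN _ _))// subrK.
have cg : continuous g.
  exact: (@lipschitz_continuous R 'rV[R]_(n * n) R^o _ _ gB).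
(* A nonzero matrix could be normalised into the sphere, so an empty sphere (size 0) means that
   every matrix is zero and any constant serves. *)
have [S0|S0] := pselect (S !=set0)%classic; last first.
  exists 1 => // M; have [->|M0] := eqVneq M 0.
    by rewrite normr0 mul1r matrix_norm_ge0.
  exfalso; apply: S0; exists (`|M|^-1 *: mxvec M).
  rewrite /S/= normrZ normfV normr_id -mx_norm_vec_mx mxvecK mulVf//.
  by rewrite normr_eq0.
have cS : compact S.
  apply: bounded_closed_compact.
    by exists 1; split => // x x1 v /= ->; exact: ltW.
  rewrite (_ : S = Num.norm @^-1` [set (1 : R)])%classic//.
  by apply: closed_comp => [v _|]; [exact: norm_continuous|exact: closed_eq].
have [v Sv gv] := @EVT_min_rV _ _ g S S0 cS (continuous_subspaceT cg).
rewrite inE /S/= in Sv.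
have gv0 : 0 < g v.
  rewrite lt_neqAle matrix_norm_ge0// andbT eq_sym; apply/eqP => gv0.
  have := matrix_norm_eq0 nN gv0 => /(congr1 mxvec); rewrite vec_mxK linear0.
  by move=> v0; move: Sv; rewrite v0 normr0 => /eqP; rewrite eq_sym oner_eq0.
exists (g v)^-1; first by rewrite invr_gt0.
move=> M; have [->|M0] := eqVneq M 0.
  by rewrite normr0 mulr_ge0 ?matrix_norm_ge0// invr_ge0 ltW.
rewrite ler_pdivlMl// mulrC -ler_pdivlMl ?normr_gt0//.
have := gv (`|M|^-1 *: mxvec M); rewrite /g linearZ/= mxvecK matrix_normZ//.
rewrite normfV normr_id; apply; rewrite inE /S/=.
rewrite normrZ normfV normr_id -mx_norm_vec_mx mxvecK mulVf//.
by rewrite normr_eq0.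
Qed.

End MatrixNorm.

(** * The determinant identity for symplectic methods in the plane *)

Section SymplecticAlgebra.
Context {R : comNzRingType}.

Lemma sum_ord2 (V : nmodType) (F : 'I_2 -> V) : \sum_i F i = F 0 + F 1.
Proof. by rewrite big_ord_recl big_ord1; congr (_ + F _); apply: val_inj. Qed.

Lemma det_mx22 (M : 'M[R]_2) : \det M = M 0 0 * M 1 1 - M 0 1 * M 1 0.
Proof.
rewrite (expand_det_row _ 0) sum_ord2 /cofactor !det_mx11 !mxE /=.
rewrite expr0 expr1 mul1r mulN1r mulrN.
by congr (_ * M _ _ - _ * M _ _); apply: val_inj.
Qed.

Lemma mx22P (A B : 'M[R]_2) : A 0 0 = B 0 0 -> A 0 1 = B 0 1 ->
  A 1 0 = B 1 0 -> A 1 1 = B 1 1 -> A = B.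
Proof.
have ord2 (i : 'I_2) : i = 0 \/ i = 1.
  by case: i => -[|[|//]] ?; [left|right]; apply: val_inj.
by move=> *; apply/matrixP => i j; case: (ord2 i) => ->; case: (ord2 j) => ->.
Qed.

(** The standard symplectic matrix J, with rows (0, 1) and (-1, 0). *)
Definition skew_mx : 'M[R]_2 :=
  \matrix_(i, j) (((i == 0) && (j == 1))%:R - ((i == 1) && (j == 0))%:R).

Lemma skew_mx_congr (M : 'M[R]_2) : M *m skew_mx *m M^T = \det M *: skew_mx.
Proof.
by apply: mx22P; rewrite det_mx22 !(mxE, sum_ord2)/=; ring.
Qed.

Lemma skew_mx_trace (M : 'M[R]_2) :
  M *m skew_mx + skew_mx *m M^T = \tr M *: skew_mx.
Proof.
by apply: mx22P; rewrite /mxtrace !(mxE, sum_ord2)/=; ring.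
Qed.

Lemma scale_skew_mx_inj : injective ( *:%R^~ skew_mx : R -> 'M[R]_2).
Proof.
by move=> x y /matrixP/(_ 0 1); rewrite !mxE/= subr0 !mulr1.
Qed.

(* Jacobians here are transposed ('J acts on row vectors from the right), so the
   chain rule reads M j *m F j; the step size is absorbed in F. *)
Lemma runge_kutta_det s (a : 'M[R]_s) (b : 'I_s -> R)
    (F M : 'I_s -> 'M[R]_2) (A : 'M[R]_2) :
  (forall i j, b i * b j - b i * a i j - b j * a j i = 0) ->
  (forall i, M i = 1%:M + \sum_j a i j *: (M j *m F j)) ->
  A = 1%:M + \sum_j b j *: (M j *m F j) ->
  \det A = 1 + \sum_i b i * \tr (F i) * \det (M i).
Proof.
move=> symp ME AE; apply: scale_skew_mx_inj => /=.
pose J := skew_mx; pose K i := M i *m F i.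
(* Polarisation of [M J M^T]: since [w A A] is [\det A *: J], the determinant expands like a
   square. *)
pose w X Y : 'M[R]_2 := X *m J *m Y^T.
have wDl X X' Y : w (X + X') Y = w X Y + w X' Y by rewrite /w !mulmxDl.
have wDr X Y Y' : w X (Y + Y') = w X Y + w X Y'.
  by rewrite /w linearD mulmxDr.
have wZl c X Y : w (c *: X) Y = c *: w X Y by rewrite /w -!scalemxAl.
have wZr c X Y : w X (c *: Y) = c *: w X Y by rewrite /w linearZ -scalemxAr.
have w0l Y : w 0 Y = 0 by rewrite /w !mul0mx.
have w0r X : w X 0 = 0 by rewrite /w trmx0 mulmx0.
have wsl (G : 'I_s -> 'M[R]_2) Y : w (\sum_j G j) Y = \sum_j w (G j) Y.
  exact: (big_morph (w^~ Y) (fun X X' => wDl X X' Y) (w0l Y)).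
have wsr (G : 'I_s -> 'M[R]_2) X : w X (\sum_j G j) = \sum_j w X (G j).
  exact: (big_morph (w X) (wDr X) (w0r X)).
(* The stage equation is solved for the identity, [1 = M i - \sum_j a i j *: K j], so that the
   linear terms become a trace term plus terms quadratic in the [K j]. *)
have wKM i : w (K i) 1%:M + w 1%:M (K i) =
    (\tr (F i) * \det (M i)) *: J
      - \sum_j a i j *: (w (K i) (K j) + w (K j) (K i)).
  transitivity (w (K i) (M i) + w (M i) (K i)
      - \sum_j a i j *: (w (K i) (K j) + w (K j) (K i))).
    have -> : \sum_j a i j *: (w (K i) (K j) + w (K j) (K i)) =
        \sum_j a i j *: w (K i) (K j) + \sum_j a i j *: w (K j) (K i).
      by rewrite -big_split; apply: eq_bigr => j _; rewrite scalerDr.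
    rewrite {1 2}ME wDl wDr wsl wsr opprD.
    under eq_bigr do rewrite wZr.
    under [X in _ + (_ + X) + _]eq_bigr do rewrite wZl.
    by rewrite addrACA !addrK.
  congr (_ - _); rewrite /w /K trmx_mul !mulmxA.
  rewrite -[M i *m F i *m J]mulmxA -mulmxDl -[M i *m J *m _]mulmxA -mulmxDr.
  by rewrite skew_mx_trace -scalemxAr -scalemxAl skew_mx_congr scalerA.
transitivity (w A A); first by rewrite /w skew_mx_congr.
have {}AE : A = 1%:M + \sum_j b j *: K j by [].
rewrite AE wDl !wDr; set S := \sum_j _.
have -> : w 1%:M 1%:M = J by rewrite /w trmx1 mul1mx mulmx1.
rewrite -addrA scalerDl scale1r; congr (_ + _); rewrite addrA.
have -> : w 1%:M S + w S 1%:M =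
    \sum_i ((b i * \tr (F i) * \det (M i)) *: J
      - \sum_j ((b i * a i j) *: w (K i) (K j)
               + (b i * a i j) *: w (K j) (K i))).
  rewrite addrC wsl wsr -big_split/=; apply: eq_bigr => i _.
  rewrite wZl wZr -scalerDr wKM scalerBr scalerA mulrA; congr (_ - _).
  rewrite scaler_sumr; apply: eq_bigr => j _.
  by rewrite scalerA scalerDr.
have -> : w S S = \sum_i \sum_j (b i * b j) *: w (K i) (K j).
  rewrite wsl; apply: eq_bigr => i _; rewrite wsr; apply: eq_bigr => j _.
  by rewrite wZl wZr scalerA.
(* Once the indices are exchanged in one of the double sums, [w (K i) (K j)] has coefficient
   [b i * b j - b i * a i j - b j * a j i], which is zero by symplecticity. *)
rewrite sumrB -scaler_suml -addrA -[RHS]addr0; congr (_ + _); symmetry.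
under [X in - X]eq_bigr do rewrite big_split/=.
rewrite big_split/= [X in - (_ + X)]exchange_big/= opprD addrAC addrC -!sumrN.
rewrite -!big_split/= big1// => i _; rewrite -!sumrN -!big_split/= big1// => j _.
rewrite -!scaleNr -!scalerDl (_ : _ + _ = 0) ?scale0r//.
by rewrite -(symp i j); ring.
Qed.

End SymplecticAlgebra.

(** * Differentials, linear approximation and Lipschitz bounds *)

Section Differential.
Context {R : realType}.

Lemma diff_near_le (V W : normedModType R) (f : V -> W) (x : V) :
  differentiable f x -> forall e : R, 0 < e ->
  \forall v \near (0 : V), `|f (v + x) - f x - ('d f x : V -> W) v| <= e * `|v|.
Proof.
move=> /diff_locallyP[_ /eqaddoP df] e e0; apply: filterS (df _ e0) => v.
by rewrite opprD addrA.
Qed.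

Lemma near_le_differentiable (V W : normedModType R) (f : V -> W)
    (D : {linear V -> W}) (x : V) : continuous D ->
  (forall e : R, 0 < e ->
   \forall v \near (0 : V), `|f (v + x) - f x - D v| <= e * `|v|) ->
  differentiable f x.
Proof.
move=> cD fD.
have fE : f \o shift x = cst (f x) + D +o_ (0 : V) id.
  apply/eqaddoP => e e0; apply: filterS (fD _ e0) => v.
  by rewrite opprD addrA.
by apply/diff_locallyP; rewrite (diff_unique cD fE).
Qed.

(** The differential is a limit of difference quotients based at [x], each bounded by [q * |v|]. *)
Lemma diff_norm_le (V W : normedModType R) (f : V -> W) (q : R) x :
  differentiable f x -> (forall y, `|f y - f x| <= q * `|y - x|) ->
  forall v, `|('d f x : V -> W) v| <= q * `|v|.
Proof.
move=> df fq v; rewrite -deriveE//.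
have dv : derivable f x v := diff_derivable df.
rewrite /derive -lim_norm//; apply: limr_le; first exact: is_cvg_norm.
near=> h.
have h0 : h != 0 by near: h; exact: nbhs_dnbhs_neq.
rewrite normrZ normfV ler_pdivrMl ?normr_gt0//.
by rewrite (le_trans (fq _))// addrK normrZ mulrCA.
Unshelve. all: by end_near. Qed.

(** The scalar mean value theorem is applied to each entry along the segment from [y] to [x]. The
    intermediate point depends on the entry, which is harmless for a maximum norm. *)
Lemma lipschitz_of_diff_norm_le (V : normedModType R) m n (f : V -> 'M[R]_(m, n))
    (K : R) : (forall x, differentiable f x) ->
  (forall x v, `|('d f x : V -> 'M[R]_(m, n)) v| <= K * `|v|) ->
  forall x y, `|f x - f y| <= K * `|x - y|.
Proof.
move=> df fK x y; apply/mx_norm_leP.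
  by rewrite (le_trans _ (fK 0 (x - y))).
move=> i j.
pose p (t : R) := y + t *: (x - y).
pose phi (t : R) : R := f (p t) i j.
have dp (t : R) : is_diff t p ( *:%R^~ (x - y)).
  by apply: is_diff_eq; rewrite ?add0r.
have dphi (t : R) : is_derive t 1 phi (('d f (p t) : V -> 'M[R]_(m, n)) (x - y) i j).
  have dfp : differentiable (f \o p) t.
    by apply: differentiable_comp; [exact: ex_diff|].
  have -> : ('d f (p t) : V -> 'M[R]_(m, n)) (x - y) = 'D_1 (f \o p) t.
    rewrite deriveE// (@diff_comp _ _ _ _ p f)//.
    have -> := @diff_val _ _ _ _ _ _ _ (dp t).
    by rewrite /= scale1r.
  have Dfp : derivable (f \o p) t 1 by exact: diff_derivable.
  rewrite derive_mx// mxE.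
  by apply: DeriveDef => //; exact: (derivable_mxP _ _ _).1.
have [|c _] := @MVT_segment R phi _ 0 1 ler01 (fun t _ => dphi t).
  apply: continuous_subspaceT => t; apply: differentiable_continuous.
  by apply/derivable1_diffP.
rewrite /phi /p scale1r scale0r addr0 subr0 mulr1 [y + _]addrC subrK => fE.
have := fK (p c) (x - y); apply: le_trans.
rewrite !mxE fE.
exact: mx_norm_coord.
Qed.

End Differential.

(** * Fixed points of contractions and their dependence on parameters *)

Section Contraction.
Context {R : realType} {E : completeNormedModType R}.

Lemma lipschitz_fixed_point (T : E -> E) (q : R) : 0 <= q < 1 ->
  (forall y z, `|T y - T z| <= q * `|y - z|) -> exists y, y = T y.
Proof.
move=> /andP[q0 q1] Tq.
have TT : {homo T : y / [set: E]%classic y >-> [set: E]%classic y} by [].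
have cT : is_contraction (mkfun TT).
  by exists (NngNum q0); split=> //= -[y z] _; exact: Tq.
have [||y _ yT] := banach_fixed_point cT.
- exact: closedT.
- by exists 0.
- by exists y.
Qed.

Lemma lipschitz_fixed_point_unique (V : normedModType R) (T : V -> V) (q : R) y z :
  q < 1 -> (forall y z, `|T y - T z| <= q * `|y - z|) ->
  y = T y -> z = T z -> y = z.
Proof.
move=> q1 Tq yT zT; apply/eqP; rewrite -subr_eq0 -normr_le0.
by have := Tq y z; rewrite -yT -zT; nra.
Qed.

(** Uniqueness of the fixed point makes the solution linear in [v]; [(1 - q) * |D v| <= k * |v|],
    with [k] a bound for [P], makes it continuous. *)
Lemma linear_fixed_point (V : normedModType R) (P : {linear V -> E})
    (A : {linear E -> E}) (q : R) : 0 <= q < 1 -> continuous P ->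
  (forall y, `|A y| <= q * `|y|) ->
  exists2 D : {linear V -> E}, continuous D & forall v, D v = P v + A (D v).
Proof.
move=> q01 cP Aq.
have Tq v y z : `|(P v + A y) - (P v + A z)| <= q * `|y - z|.
  by rewrite opprD addrACA subrr add0r -linearB.
have /choice[D0 D0E] : forall v, exists y, y = P v + A y.
  by move=> v; exact: (lipschitz_fixed_point q01 (Tq v)).
have uD v y : y = P v + A y -> y = D0 v.
  move=> yE; case/andP: q01 => _ q1.
  exact: (lipschitz_fixed_point_unique q1 (Tq v)).
have linD : linear D0.
  move=> k u v; apply/esym/uD; rewrite !linearP addrACA -scalerDr.
  by rewrite -D0E -D0E.
pose DL := GRing.isLinear.Build _ _ _ _ _ linD.
pose D : {linear V -> E} := HB.pack D0 DL.
exists D => //.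
have [k k0 Pk] := linear_lipschitz cP.
apply: (@lipschitz_continuous _ _ _ _ (k / (1 - q))) => x y.
rewrite -linearB; move: (x - y) => v.
rewrite mulrAC ler_pdivlMr; last by case/andP: q01; rewrite subr_gt0.
have /le_trans : `|D v| <= `|P v| + `|A (D v)|.
  by rewrite {1}[D v]D0E ler_normD.
move=> /(_ _ (lerD (Pk v) (Aq _))) DP.
by rewrite mulrBr mulr1 lerBlDr [_ * q]mulrC.
Qed.

(* The derivative D of the solution solves the linearised equation
   D v = P v + G'(U x) (D v); that equation is again a contraction, and the
   error U (v + x) - U x - D v is controlled by the remainder of G alone. *)
Lemma fixed_point_differentiable (V : normedModType R) (P : {linear V -> E})
    (G : E -> E) (U : V -> E) (q : R) (x : V) : 0 <= q < 1 -> continuous P ->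
  (forall y z, `|G y - G z| <= q * `|y - z|) ->
  differentiable G (U x) -> (forall v, U v = P v + G (U v)) ->
  differentiable U x.
Proof.
move=> q01 cP Gq dG UE; have /andP[q0 q1] := q01.
have q1' : 0 < 1 - q by rewrite subr_gt0.
have Aq := diff_norm_le dG (fun y => Gq y (U x)).
have [k k0 Pk] := linear_lipschitz cP.
have [D cD DE] := linear_fixed_point q01 cP Aq.
have Ulip v w : `|U v - U w| <= k / (1 - q) * `|v - w|.
  rewrite mulrAC ler_pdivlMr//.
  have : `|U v - U w| <= `|P (v - w)| + `|G (U v) - G (U w)|.
    by rewrite {1}UE [X in _ - X]UE opprD addrACA -linearB ler_normD.
  have := Pk (v - w); have := Gq (U v) (U w); nra.
apply: (near_le_differentiable cD) => e e0.
pose c := k / (1 - q); have c0 : 0 < c by rewrite divr_gt0.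
(* As [|w| <= c * |v|], this tolerance bounds the remainder of [G] by [(1 - q) * e * |v|]; moving
   the term [q * |w - D v|] to the left then leaves exactly [e * |v|]. *)
have eta0 : 0 < (1 - q) * e / c by rewrite divr_gt0// mulr_gt0.
have /nbhs_ballP[r /= r0 Gr] := diff_near_le dG eta0.
near=> v.
set w := U (v + x) - U x.
have wv : `|w| <= c * `|v| by rewrite -[v in leRHS](addrK x) Ulip.
have wr : `|w| < r.
  rewrite (le_lt_trans wv)// -ltr_pdivlMl// -normrN -sub0r.
  near: v; apply: filterS (nbhsx_ballx (0 : V) (c^-1 * r) _) => [v|].
    by rewrite -ball_normE.
  by rewrite mulr_gt0// invr_gt0.
have /Gr : ball (0 : E) r w by rewrite -ball_normE /= sub0r normrN.
rewrite subrK => Gw.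
pose A : {linear E -> E} := 'd G (U x).
have wE : w - D v = (G (U (v + x)) - G (U x) - A w) + A (w - D v).
  rewrite (linearB A w (D v)) addrA subrK {1}/w {1}UE [X in _ - X - D v]UE DE -/A.
  by rewrite linearD opprD addrACA addrK opprD addrACA subrr add0r -DE.
have : `|w - D v| <= (1 - q) * e / c * `|w| + q * `|w - D v|.
  by rewrite {1}wE (le_trans (ler_normD _ _))// lerD.
have : (1 - q) * e / c * `|w| <= (1 - q) * (e * `|v|).
  rewrite mulrAC ler_pdivrMr// -mulrA -!mulrA ler_pM2l// ler_pM2l//.
  by rewrite mulrC.
nra.
Unshelve. all: by end_near. Qed.

End Contraction.

(* The library equips matrices with completeness and with a norm, but does not
   register the join of the two structures. *)
HB.instance Definition _ (R : realType) (m n : nat) := Complete.on 'M[R]_(m, n).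

(** * Jacobian matrices and the derivative of a Runge-Kutta step *)

Section Jacobian.
Context {R : realType}.

Lemma diff_jacobian m n (f : 'rV[R]_m -> 'rV[R]_n) x v :
  ('d f x : 'rV[R]_m -> 'rV[R]_n) v = v *m 'J f x.
Proof. by rewrite /jacobian mul_rV_lin1. Qed.

Lemma diff_norm_le_jacobian m n (f : 'rV[R]_m -> 'rV[R]_n) x v :
  `|('d f x : 'rV[R]_m -> 'rV[R]_n) v| <= m%:R * `|'J f x| * `|v|.
Proof. by rewrite diff_jacobian mulrAC mx_norm_mul. Qed.

(** Each row of the Jacobian is the image of a basis vector, whose norm is at most 1. *)
Lemma jacobian_norm_le m n (f : 'rV[R]_m -> 'rV[R]_n) x (q : R) : 0 <= q ->
  (forall v, `|('d f x : 'rV[R]_m -> 'rV[R]_n) v| <= q * `|v|) ->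
  `|'J f x| <= q.
Proof.
move=> q0 fq; apply/mx_norm_leP => // i j.
have -> : 'J f x i j = ('d f x : 'rV[R]_m -> 'rV[R]_n) (delta_mx 0 i) 0 j.
  by rewrite diff_jacobian -rowE [RHS]mxE.
rewrite (le_trans (mx_norm_coord _ _ _))// (le_trans (fq _))// ler_piMr//.
by apply/mx_norm_leP => // k l; rewrite mxE normr_nat lern1 leq_b1.
Qed.

(** Stages and new point have the same shape: [c] will be a row of [a] or the weights [b]. *)
Lemma jacobian_step n s (f : 'rV[R]_n -> 'rV[R]_n)
    (X : 'I_s -> 'rV[R]_n -> 'rV[R]_n) (h : R) (c : 'I_s -> R) x :
  (forall y, differentiable f y) -> (forall i, differentiable (X i) x) ->
  let Z y := y + h *: \sum_j c j *: f (X j y) in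
  differentiable Z x /\
  'J Z x = 1%:M + \sum_j (h * c j) *: ('J (X j) x *m 'J f (X j x)).
Proof.
move=> df dX Z.
have ZE : Z = id + h *: \sum_j c j *: (f \o X j).
  by apply/funext => y; rewrite /Z !fctE fct_sumE.
have dfX j : differentiable (f \o X j) x by exact: differentiable_comp.
have dcfX j : differentiable (c j *: (f \o X j)) x by exact: differentiableZ.
have dS : differentiable (\sum_j c j *: (f \o X j)) x.
  exact: differentiable_sum.
split; first by rewrite ZE; apply: differentiableD => //; exact: differentiableZ.
apply/row_matrixP => i; rewrite !rowE -diff_jacobian.
set v := delta_mx _ _.
rewrite mulmxDr mulmx1 mulmx_sumr ZE -deriveE; last first.
  by apply: differentiableD => //; exact: differentiableZ.
rewrite deriveD//; last first.
  by apply: diff_derivable; exact: differentiableZ.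
rewrite deriveZ ?derive_id ?derive_sum//=; last 2 first.
  by move=> j; exact: diff_derivable.
  by exact: diff_derivable.
congr (_ + _); rewrite scaler_sumr; apply: eq_bigr => j _.
rewrite deriveZ; last exact: diff_derivable.
rewrite deriveE// diff_comp//= !diff_jacobian scalerA.
by rewrite -scalemxAr mulmxA.
Qed.

End Jacobian.

(** * Unique and differentiable solvability of the stage equations *)

Section RungeKutta.
Context {R : realType}.

(** The contraction constant is [q <= 1/2], so the solution is Lipschitz in the starting point with
    constant [1 / (1 - q) <= 2]. *)
Lemma runge_kutta_determines n s (a : 'M[R]_s) (b : 'I_s -> R)
    (f : 'rV[R]_n -> 'rV[R]_n) (h c : R) :
  (forall x, differentiable f x) ->
  (forall x y, `|f x - f y| <= c * `|x - y|) ->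
  0 <= h -> 0 <= c -> h * (s%:R * `|a| * c) <= 2^-1 ->
  exists X g, determines (runge_kutta n a b) h f X g /\
    forall i x y, `|X i x - X i y| <= 2 * `|x - y|.
Proof.
move=> df fc h0 c0 q2; set q := h * _ in q2.
have q01 : 0 <= q < 1.
  by apply/andP; split; [rewrite !mulr_ge0|lra].
(* The stage equations become [Y = P x + G Y], where [P] copies [x] into every row. Writing [G] with
   columns of [a] exhibits it as built from [f] and linear maps, hence differentiable. *)
pose G (Y : 'M[R]_(s, n)) := h *: \sum_j col j a *m f (row j Y).
pose P : {linear 'rV[R]_n -> 'M[R]_(s, n)} := mulmx (const_mx 1 : 'cV[R]_s).
have Pn v : `|P v| <= `|v|.
  apply/mx_norm_leP => // i j; rewrite !mxE big_ord1 mxE mul1r.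
  exact: mx_norm_coord.
have cP : continuous P.
  apply: (@lipschitz_continuous _ _ _ _ 1) => x y.
  by rewrite -linearB mul1r.
have rowP i v Y : row i (P v + G Y) = v + h *: \sum_j a i j *: f (row j Y).
  rewrite linearD; congr (_ + _).
    by apply/rowP => j; rewrite !mxE big_ord1 mxE mul1r.
  rewrite /G linearZ linear_sum; congr (_ *: _); apply: eq_bigr => j _.
  by apply/rowP => k; rewrite !mxE big_ord1 !mxE.
have rowB i (Y Z : 'M[R]_(s, n)) : `|row i Y - row i Z| <= `|Y - Z|.
  by rewrite -linearB; apply/mx_norm_leP => // k l; rewrite mxE mx_norm_coord.
have Gq Y Z : `|G Y - G Z| <= q * `|Y - Z|.
  rewrite /G -scalerBr normrZ ger0_norm// -mulrA ler_wpM2l// -sumrB.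
  rewrite (le_trans (ler_norm_sum _ _ _))//.
  apply: (@le_trans _ _ (\sum_(j < s) `|a| * c * `|Y - Z|)).
    apply: ler_sum => j _; rewrite -mulmxBr (le_trans (mx_norm_mul _ _))//.
    rewrite mul1r -mulrA ler_pM//.
      by apply/mx_norm_leP => // k l; rewrite mxE mx_norm_coord.
    by rewrite (le_trans (fc _ _))// ler_wpM2l.
  by rewrite sumr_const card_ord -!mulrA mulr_natl.
have drow i Y : differentiable (row i : 'M[R]_(s, n) -> 'rV[R]_n) Y.
  apply: linear_differentiable; apply: (@lipschitz_continuous _ _ _ _ 1) => A B.
  by rewrite mul1r; exact: rowB.
have dG Y : differentiable G Y.
  have -> : G = h *: \sum_j (mulmx (col j a) \o (f \o row j)).
    by apply/funext => Z; rewrite /G !fctE fct_sumE.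
  apply: differentiableZ; apply: differentiable_sum => j.
  apply: differentiable_comp; first exact: differentiable_comp.
  apply: linear_differentiable.
  apply: (@lipschitz_continuous _ _ _ _ (1%:R * `|col j a|)) => u v.
  by rewrite -linearB mx_norm_mul.
have Tq v Y Z : `|(P v + G Y) - (P v + G Z)| <= q * `|Y - Z|.
  by rewrite opprD addrACA subrr add0r.
have /choice[U UE] : forall v, exists Y : 'M[R]_(s, n), Y = P v + G Y.
  by move=> v; exact: lipschitz_fixed_point q01 (Tq v).
have dU x : differentiable U x.
  exact: (fixed_point_differentiable q01 cP Gq).
pose X i x := row i (U x).
have dX i x : differentiable (X i) x by exact: differentiable_comp.
exists X, (fun x => x + h *: \sum_j b j *: f (X j x)); split; last first.
  move=> i x y; rewrite (le_trans (rowB _ _ _))//.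
  have : `|U x - U y| <= `|P (x - y)| + `|G (U x) - G (U y)|.
    by rewrite {1}UE [X in _ - X]UE opprD addrACA -linearB ler_normD.
  have := Pn (x - y); have := Gq (U x) (U y); have := normr_ge0 (U x - U y).
  nra.
split=> //.
- by move=> x; split=> // i; rewrite /X {1}UE rowP.
- move=> x Y y [YE yE].
  (* Any solution, stacked by rows, is a fixed point, hence the one chosen. *)
  have YU : \matrix_i Y i = U x.
    case/andP: q01 => _ q1.
    apply: (lipschitz_fixed_point_unique q1 (Tq x)) => //.
    apply/row_matrixP => i; rewrite rowP rowK YE.
    by under [in RHS]eq_bigr do rewrite rowK.
  have YX i : Y i = X i x by rewrite /X -YU rowK.
  by split=> //; rewrite yE; under eq_bigr do rewrite YX.
- by move=> x; have [] := jacobian_step h b df (dX ^~ x).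
Qed.

End RungeKutta.

(** * Determinant estimates and the choice of the step size bound *)

(** Diagonal entries lie in [3/4, 5/4] and the others in [-1/4, 1/4], so the determinant lies
    between 1/2 and 13/8. *)
Lemma det_mx22_near1 (R : realType) (M : 'M[R]_2) :
  `|M - 1%:M| <= 4^-1 -> 0 <= \det M <= 2.
Proof.
move=> /mx_norm_leP M1; have {}M1 i j : `|(M - 1%:M) i j| <= 4^-1.
  by apply: M1; rewrite invr_ge0.
move: (M1 0 0) (M1 0 1) (M1 1 0) (M1 1 1); rewrite det_mx22 !mxE/= !subr0.
rewrite !ler_norml => /andP[? ?] /andP[? ?] /andP[? ?] /andP[? ?].
by apply/andP; split; nra.
Qed.

Lemma lipschitz_of_jacobian_matrix_norm_le (R : realType) n (f : 'rV[R]_n -> 'rV[R]_n)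
    (K : R) :
  (forall x, differentiable f x) -> (forall x, `|jacobian_matrix f x| <= K) ->
  forall x y, `|f x - f y| <= n%:R * K * `|x - y|.
Proof.
move=> df fK; apply: (lipschitz_of_diff_norm_le df) => x v.
rewrite (le_trans (diff_norm_le_jacobian _ _ _))// ler_wpM2r// ler_wpM2l//.
by rewrite -mx_norm_tr fK.
Qed.

Unset Implicit Arguments.

Theorem proposition4 (R : realType) (s : nat) (hs : (1 <= s)%N)
  (a : 'M[R]_s) (b : 'I_s -> R)
  (hsymp : symplectic a b) (hb : forall i, 0 < b i) :
  contractive_integrator (runge_kutta 2 a b).
Proof.
move=> N nN L L0.
have [C C0 NC] := mx_norm_le_matrix_norm nN.
(* [c] is a Lipschitz constant of [f], with the factor 2 from the dimension, and [h * kap] is the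
   contraction constant of the stage equations. *)
pose c : R := 2 * (C * L); pose kap : R := s%:R * `|a| * c.
pose beta := \sum_i b i.
have K0 : 0 < C * L by rewrite mulr_gt0.
have c0 : 0 < c by rewrite mulr_gt0.
have kap0 : 0 <= kap by rewrite !mulr_ge0// ltW.
have beta0 : 0 <= beta by apply: sumr_ge0 => i _; exact: ltW.
have D0 : 0 < 1 + 8 * kap + c * beta by have := mulr_ge0 (ltW c0) beta0; lra.
(* The term [8 * kap] keeps the stage Jacobians near the identity, [c * beta] yields the lower bound
   on the determinant, and 1 keeps the denominator positive. *)
exists (1 + 8 * kap + c * beta)^-1; first by rewrite invr_gt0.
move=> h /andP[h0]; rewrite -[_^-1]mul1r ltr_pdivlMr// => hD.
have [hkap hbeta] : h * kap <= 8^-1 /\ h * c * beta <= 1.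
  have := mulr_ge0 (ltW h0) kap0.
  have := mulr_ge0 (mulr_ge0 (ltW h0) (ltW c0)) beta0.
  by split; lra.
move=> f [df _] fL trf.
have fK x : `|jacobian_matrix f x| <= C * L.
  by rewrite (le_trans (NC _))// ler_wpM2l// ltW.
have JfK x : `|'J f x| <= C * L by rewrite -mx_norm_tr fK.
have flip := lipschitz_of_jacobian_matrix_norm_le df fK.
have q2 : h * (s%:R * `|a| * c) <= 2^-1 by rewrite (le_trans hkap)//; lra.
have [X [g [Xg Xlip]]] :=
  runge_kutta_determines b df flip (ltW h0) (ltW c0) q2.
exists X, g; split=> // x; case: Xg => XgE _ dX _.
have M2 i : `|'J (X i) x| <= 2.
  apply: jacobian_norm_le => //; apply: diff_norm_le => // y; exact: Xlip.
have XE i : X i = fun y => y + h *: \sum_j a i j *: f (X j y).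
  by apply/funext => y; have [] := XgE y.
have gE : g = fun y => y + h *: \sum_j b j *: f (X j y).
  by apply/funext => y; have [] := XgE y.
pose F j := h *: 'J f (X j x).
have step (d : 'I_s -> R) :
    \sum_j (h * d j) *: ('J (X j) x *m 'J f (X j x)) =
    \sum_j d j *: ('J (X j) x *m F j).
  by apply: eq_bigr => j _; rewrite /F -scalemxAr scalerA mulrC.
have ME i : 'J (X i) x = 1%:M + \sum_j a i j *: ('J (X j) x *m F j).
  rewrite -step {1}XE.
  by have [_ ->] := jacobian_step h (a i) df (dX ^~ x).
have AE : 'J g x = 1%:M + \sum_j b j *: ('J (X j) x *m F j).
  rewrite -step {1}gE.
  by have [_ ->] := jacobian_step h b df (dX ^~ x).
(* The distance of the stage Jacobian from the identity is at most [2 * h * kap <= 1/4]. *)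
have M1 i : 0 <= \det ('J (X i) x) <= 2.
  apply: det_mx22_near1; rewrite ME addrAC subrr add0r.
  apply: (@le_trans _ _ (\sum_(j < s) `|a| * (2 * (h * c)))); last first.
    rewrite sumr_const card_ord -mulr_natl.
    move: hkap; rewrite /kap; lra.
  rewrite (le_trans (ler_norm_sum _ _ _))//; apply: ler_sum => j _.
  rewrite normrZ ler_pM ?mx_norm_coord//.
  rewrite (le_trans (mx_norm_mul _ _))// normrZ (gtr0_norm h0).
  rewrite [leRHS](_ : _ = 2 * 2 * (h * (C * L))); last by rewrite /c; ring.
  by rewrite ler_pM// ?ler_pM2l// ?mulr_ge0// ltW.
(* The upper bound is contractivity of the ODE; below, each of the two diagonal entries of the
   Jacobian of [f] is at least [- (C * L)]. *)
have trF i : - (h * c) <= \tr (F i) <= 0.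
  rewrite mxtraceZ; apply/andP; split; last first.
    by rewrite pmulr_rle0// -mxtrace_tr; exact: trf.
  rewrite -mulrN ler_pM2l// /mxtrace sum_ord2 /c.
  have := mx_norm_coord ('J f (X i x)) 0 0; have := JfK (X i x).
  have := mx_norm_coord ('J f (X i x)) 1 1.
  have := ler_norm (- ('J f (X i x)) 0 0); have := ler_norm (- ('J f (X i x)) 1 1).
  by rewrite !normrN; lra.
rewrite /jacobian_matrix det_tr (runge_kutta_det hsymp ME AE) ler_norml.
have Fle i : - (2 * (h * c)) <= \tr (F i) * \det ('J (X i) x) <= 0.
  have /andP[? ?] := trF i; have /andP[? ?] := M1 i.
  by apply/andP; split; nra.
(* Positive weights make every term nonpositive, so the determinant is at most 1. *)
apply/andP; split; last first.
  rewrite gerDl sumr_le0// => i _.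
  by rewrite -mulrA pmulr_rle0//; have /andP[] := Fle i.
(* Since [h * c * beta <= 1], the sum is at least -2 and the determinant at least -1. *)
have : - (2 * (h * c * beta)) <= \sum_i b i * \tr (F i) * \det ('J (X i) x).
  rewrite /beta !mulr_sumr -sumrN; apply: ler_sum => i _.
  by have /andP[/(ler_wpM2l (ltW (hb i))) + _] := Fle i; lra.
lra.
Qed.
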